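(* Let $R$ be a ring, $f:M\to M'$ an epimorphism (surjective homomorphism) of $R$-modules, and let $N\subsetneq M$ and $N'\subsetneq M'$ be proper submodules. Then: (1) If $N$ is a gsdf-absorbing submodule of $M$ with $\ker(f)\subseteq N$, then $f(N)$ is a gsdf-absorbing submodule of $M'$. (2) If $N'$ is a gsdf-absorbing submodule of $M'$ and $f^{-1}(N')\neq M$, then $f^{-1}(N')$ is a gsdf-absorbing submodule of $M$.
   Context: All rings are commutative with identity $1\neq 0$ and all modules are unital. Let $R$ be a ring and $M$ an $R$-module. A proper submodule $N$ of $M$ is called a generalized square-difference factor absorbing submodule (gsdf-absorbing submodule) if for all $u,v\in R$ and $x\in M$, the condition $(u^{2}-v^{2})x\in N$ implies that $(u-v)x\in N$ or $(u+v)^{k}x\in N$ for some integer $k\geq 1$. *)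

(* Defs.v *)
From HB Require Import structures.
From mathcomp Require Import all_boot all_order all_algebra.
From mathcomp Require Import boolp classical_sets.

Set Implicit Arguments.
Unset Strict Implicit.
Unset Printing Implicit Defensive.

Import GRing.Theory.
Local Open Scope ring_scope.
Local Open Scope classical_set_scope.

(* Submodules are [Prop]-valued sets rather than boolean predicates because
   the image of a submodule need not be decidable; [mem N] is the (classical)
   boolean membership predicate that [submod_closed] expects. *)
Definition proper_submodule (R : comNzRingType) (M : lmodType R)
    (N : set M) : Prop :=
  GRing.submod_closed (mem N) /\ N `<` [set: M].

Definition gsdf_absorbing (R : comNzRingType) (M : lmodType R)
    (N : set M) : Prop :=
  proper_submodule N /\
  forall (u v : R) (x : M),
    N ((u ^+ 2 - v ^+ 2) *: x) ->
    N ((u - v) *: x) \/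
    exists k : nat, (1 <= k)%N /\ N ((u + v) ^+ k *: x).

(* Main.v *)
Require Import Defs.
From HB Require Import structures.
From mathcomp Require Import all_boot all_order all_algebra.
From mathcomp Require Import boolp classical_sets functions.

Set Implicit Arguments.
Unset Strict Implicit.
Unset Printing Implicit Defensive.

Import GRing.Theory.
Local Open Scope ring_scope.
Local Open Scope classical_set_scope.

(** Since [f] commutes with scalars, [f] sends [(u ^+ 2 - v ^+ 2) *: x] to the same multiple of
    [f x], and likewise for [u - v] and [(u + v) ^+ k]. The absorbing condition for the preimage at
    [x] is therefore that of [N'] at [f x], with the same [k]. For the image, [image_submod_sub_ker]
    gives that [f x] lies in the image of [N] only if [x] lies in [N]; as every element of [M'] is
    some [f x], the condition can be checked in [N] and pushed forward again. *)

Lemma submod_closedP (R : comNzRingType) (M : lmodType R) (N : set M) :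
  GRing.submod_closed (mem N) <->
  N 0 /\ forall (a : R) (u v : M), N u -> N v -> N (a *: u + v).
Proof.
split=> [[N0 Nlin]|[N0 Nlin]]; split.
- exact: set_mem N0.
- by move=> a u v Nu Nv; apply: set_mem; apply: Nlin; apply: mem_set.
- exact: mem_set.
- by move=> a u v Nu Nv; apply: mem_set; apply: Nlin; apply: set_mem.
Qed.

(** Puts properness in the form in which it is assumed for the preimage. *)
Lemma proper_submoduleP (R : comNzRingType) (M : lmodType R) (N : set M) :
  proper_submodule N <-> GRing.submod_closed (mem N) /\ N <> [set: M].
Proof. by rewrite /proper_submodule properEneq; split=> -[? ] => [[/eqP]|/eqP]. Qed.

Section LinearMap.
Variables (R : comNzRingType) (M M' : lmodType R) (f : {linear M -> M'}).

Lemma submod_closed_image (N : set M) :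
  GRing.submod_closed (mem N) -> GRing.submod_closed (mem (f @` N)).
Proof.
move=> /submod_closedP[N0 Nlin]; apply/submod_closedP; split.
  by exists 0; rewrite ?linear0.
move=> a _ _ [u Nu <-] [v Nv <-]; exists (a *: u + v); first exact: Nlin.
exact: linearP.
Qed.

Lemma submod_closed_preimage (N' : set M') :
  GRing.submod_closed (mem N') -> GRing.submod_closed (mem (f @^-1` N')).
Proof.
move=> /submod_closedP[N0 Nlin]; apply/submod_closedP.
split=> [|a u v Nu Nv] /=; first by rewrite linear0.
by rewrite linearP; apply: Nlin.
Qed.

(** If [f x = f y] with [y] in [N], then [x - y] is in the kernel, hence in [N], and so is
    [x = (x - y) + y]. *)
Lemma image_submod_sub_ker (N : set M) (x : M) :
  GRing.submod_closed (mem N) -> f @^-1` [set 0] `<=` N ->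
  (f @` N) (f x) -> N x.
Proof.
move=> /submod_closedP[_ Nlin] kerN [y Ny fyx].
rewrite -(subrK y x) -[x - y]scale1r; apply: Nlin => //.
by apply: kerN; rewrite /= linearB fyx subrr.
Qed.

End LinearMap.

Theorem proposition3p2 (R : comNzRingType) (M M' : lmodType R)
    (f : {linear M -> M'}) (f_surj : set_surj [set: M] [set: M'] f)
    (N : set M) (N' : set M')
    (hN : proper_submodule N) (hN' : proper_submodule N') :
  (gsdf_absorbing N -> f @^-1` [set 0] `<=` N -> gsdf_absorbing (f @` N)) /\
  (gsdf_absorbing N' -> f @^-1` N' <> [set: M] ->
     gsdf_absorbing (f @^-1` N')).
Proof.
split=> [[/proper_submoduleP[Nsub NT] Nabs] kerN|[/proper_submoduleP[Nsub _] Nabs] preT].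
  have Nf x := image_submod_sub_ker (x := x) Nsub kerN.
  split.
    apply/proper_submoduleP; split; first exact: submod_closed_image.
    (* If the image were all of [M'], every [f x] would lie in it, so every [x] would lie in [N]. *)
    move=> fNT; apply: NT; apply/seteqP; split=> // x _.
    by apply: Nf; rewrite fNT.
  move=> u v y; have [x _ <-] := f_surj y I.
  (* Moving the scalar inside [f] lets [Nf] pull the hypothesis back to [N]. *)
  rewrite -linearZ => /Nf /Nabs[Nx|[k [k1 Nx]]].
    by left; exists ((u - v) *: x) => //; rewrite linearZ.
  by right; exists k; split=> //; exists ((u + v) ^+ k *: x); rewrite ?linearZ.
split; first by apply/proper_submoduleP; split => //; exact: submod_closed_preimage.
move=> u v x /=; rewrite linearZ => /Nabs[Nx|[k [k1 Nx]]].
  by left; rewrite linearZ.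
by right; exists k; split; rewrite ?linearZ.
Qed.
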